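(* For every integer $n\geq 1$ the following four identities hold: (i) $\overline{A}_{N\geq O}(n)-\overline{B}_{N\geq O}(n)=p^{o}(n)-p^{e}(n)$, where $p^{o}(n)$ (resp. $p^{e}(n)$) is the number of partitions of $n$ in which the largest part appears an odd (resp. even) number of times; (ii) $\overline{A}_{N>O}(n)-\overline{B}_{N>O}(n)=p(n)$, where $p(n)$ is the number of partitions of $n$; (iii) $\overline{A}_{O\geq N}(n)-\overline{B}_{O\geq N}(n)=2D_{e}(n)$, where $D_e(n)$ is the number of partitions of $n$ into distinct parts with an even number of parts; (iv) $\overline{A}_{O>N}(n)-\overline{B}_{O>N}(n)=2H^{o}_{ON}(n)$, where $H^{o}_{ON}(n)$ is the number of overpartitions $\pi$ of $n$ such that $LN(\pi)=SN(\pi)\geq 1$, $SN(\pi)\geq LO(\pi)$, and $\pi$ has an odd number of overlined parts.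
   Context: A partition of $n$ is a finite non-increasing sequence of positive integers summing to $n$. An overpartition of $n$ is a partition of $n$ in which the first occurrence of each distinct part size may (or may not) be overlined; e.g. the overpartitions of $3$ are $(3),(\overline{3}),(2,1),(\overline{2},1),(2,\overline{1}),(\overline{2},\overline{1}),(1,1,1),(\overline{1},1,1)$. A part is of size $t$ if it equals $t$ or $\overline{t}$. For an overpartition $\pi$: $LN(\pi)$ (resp. $SN(\pi)$) is the size of the largest (resp. smallest) non-overlined part of $\pi$ if $\pi$ has non-overlined parts, and $0$ otherwise; $LO(\pi)$ (resp. $SO(\pi)$) is the size of the largest (resp. smallest) overlined part of $\pi$ if $\pi$ has overlined parts, and $0$ otherwise. $\ell_{N\geq O}(\pi)$ (resp. $\ell_{N>O}(\pi)$) is the number of non-overlined parts of $\pi$ of size $\geq SO(\pi)$ (resp. $> SO(\pi)$); $\ell_{O\geq N}(\pi)$ (resp. $\ell_{O>N}(\pi)$) is the number of overlined parts of $\pi$ of size $\geq SN(\pi)$ (resp. $>SN(\pi)$). Define: $\overline{A}_{N\geq O}(n)$ (resp. $\overline{B}_{N\geq O}(n)$) is the number of overpartitions $\pi$ of $n$ with $SO(\pi)\geq 1$ and $\ell_{N\geq O}(\pi)$ even (resp. odd); $\overline{A}_{N>O}(n)$ (resp. $\overline{B}_{N>O}(n)$) is the number of overpartitions $\pi$ of $n$ with $SO(\pi)\geq1$ and $\ell_{N>O}(\pi)$ even (resp. odd); $\overline{A}_{O\geq N}(n)$ (resp. $\overline{B}_{O\geq N}(n)$) is the number of overpartitions $\pi$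 of $n$ with $\ell_{O\geq N}(\pi)$ even (resp. odd); $\overline{A}_{O>N}(n)$ (resp. $\overline{B}_{O>N}(n)$) is the number of overpartitions $\pi$ of $n$ with $\ell_{O>N}(\pi)$ even (resp. odd). *)

(* Defs.v *)
From mathcomp Require Import all_boot all_order all_algebra.

Set Implicit Arguments.
Unset Strict Implicit.
Unset Printing Implicit Defensive.

Definition is_partition (n : nat) (s : seq nat) : bool :=
  [&& sorted geq s, all (fun x => 0 < x) s & sumn s == n].

(* A part (x, b) has size x, and it is overlined exactly when b = true. *)
Definition part : Type := (nat * bool)%type.

Definition sizes (s : seq part) : seq nat := [seq p.1 | p <- s].

(* The part at index i, if overlined, must be the first one of its size. *)
Definition is_overpartition (n : nat) (s : seq part) : bool :=
  is_partition n (sizes s) &&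
  all (fun i => (nth (0, false) s i).2 ==> (nth 0 (sizes s) i \notin take i (sizes s)))
      (iota 0 (size s)).

(* Parts of a partition of n are at most n, and there are at most n of them, so
   that partitions and overpartitions of n can be counted inside finite types
   of bounded sequences of bounded parts; see partition_bounded and
   overpartition_bounded. *)
Definition seq_of_bparts (n : nat) (s : {bseq n of 'I_n.+1}) : seq nat :=
  [seq nat_of_ord i | i <- s].

Definition seq_of_boverparts (n : nat) (s : {bseq n of 'I_n.+1 * bool}) : seq part :=
  [seq (nat_of_ord p.1, p.2) | p <- s].

Definition num_partitions (n : nat) (P : pred (seq nat)) : nat :=
  #|[set s : {bseq n of 'I_n.+1} |
      is_partition n (seq_of_bparts s) & P (seq_of_bparts s)]|.

Definition num_overpartitions (n : nat) (P : pred (seq part)) : nat :=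
  #|[set s : {bseq n of 'I_n.+1 * bool} |
      is_overpartition n (seq_of_boverparts s) & P (seq_of_boverparts s)]|.

(* Both are 0 on the empty sequence. *)
Definition largest (s : seq nat) : nat := \max_(x <- s) x.
Definition smallest (s : seq nat) : nat := \big[minn/head 0 s]_(x <- s) x.

Definition nonoverlined (s : seq part) : seq nat := [seq p.1 | p <- s & ~~ p.2].
Definition overlined (s : seq part) : seq nat := [seq p.1 | p <- s & p.2].

Definition LN (s : seq part) : nat := largest (nonoverlined s).
Definition SN (s : seq part) : nat := smallest (nonoverlined s).
Definition LO (s : seq part) : nat := largest (overlined s).
Definition SO (s : seq part) : nat := smallest (overlined s).

Definition ell_NgeO (s : seq part) : nat := count (fun x => SO s <= x) (nonoverlined s).
Definition ell_NgtO (s : seq part) : nat := count (fun x => SO s < x) (nonoverlined s).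
Definition ell_OgeN (s : seq part) : nat := count (fun x => SN s <= x) (overlined s).
Definition ell_OgtN (s : seq part) : nat := count (fun x => SN s < x) (overlined s).

Definition A_NgeO (n : nat) : nat :=
  num_overpartitions n (fun s => (1 <= SO s) && ~~ odd (ell_NgeO s)).
Definition B_NgeO (n : nat) : nat :=
  num_overpartitions n (fun s => (1 <= SO s) && odd (ell_NgeO s)).

Definition A_NgtO (n : nat) : nat :=
  num_overpartitions n (fun s => (1 <= SO s) && ~~ odd (ell_NgtO s)).
Definition B_NgtO (n : nat) : nat :=
  num_overpartitions n (fun s => (1 <= SO s) && odd (ell_NgtO s)).

Definition A_OgeN (n : nat) : nat :=
  num_overpartitions n (fun s => ~~ odd (ell_OgeN s)).
Definition B_OgeN (n : nat) : nat :=
  num_overpartitions n (fun s => odd (ell_OgeN s)).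

Definition A_OgtN (n : nat) : nat :=
  num_overpartitions n (fun s => ~~ odd (ell_OgtN s)).
Definition B_OgtN (n : nat) : nat :=
  num_overpartitions n (fun s => odd (ell_OgtN s)).

Definition num_p (n : nat) : nat := num_partitions n xpredT.

Definition p_odd (n : nat) : nat :=
  num_partitions n (fun s => odd (count_mem (largest s) s)).
Definition p_even (n : nat) : nat :=
  num_partitions n (fun s => ~~ odd (count_mem (largest s) s)).

Definition D_even (n : nat) : nat :=
  num_partitions n (fun s => uniq s && ~~ odd (size s)).

Definition H_ON_odd (n : nat) : nat :=
  num_overpartitions n
    (fun s => [&& LN s == SN s, 1 <= SN s, LO s <= SN s & odd (size (overlined s))]).

Lemma partition_size (n : nat) (s : seq nat) :
  is_partition n s -> (size s <= n) && all (fun x => x < n.+1) s.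
Proof.
case/and3P=> _ + /eqP <-.
elim: s => //= x s IHs /andP[x0 /IHs /andP[sz /allP le_s]].
rewrite -add1n leq_add //= ltnS leq_addr /=.
apply/allP=> y /le_s; rewrite !ltnS => le_y.
exact: leq_trans le_y (leq_addl _ _).
Qed.

Lemma partition_bounded (n : nat) (s : seq nat) :
  is_partition n s -> exists t : {bseq n of 'I_n.+1}, seq_of_bparts t = s.
Proof.
case/partition_size/andP=> sz /allP lt_s.
have szt : size [seq inord x : 'I_n.+1 | x <- s] <= n by rewrite size_map.
exists (Bseq szt); rewrite /seq_of_bparts /= -map_comp.
by rewrite -[RHS]map_id; apply/eq_in_map=> x /lt_s lt_x /=; rewrite inordK.
Qed.

Lemma overpartition_bounded (n : nat) (s : seq part) :
  is_overpartition n s ->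
  exists t : {bseq n of 'I_n.+1 * bool}, seq_of_boverparts t = s.
Proof.
case/andP=> /partition_size/andP[]; rewrite size_map => sz /allP lt_s _.
have szt : size [seq (inord p.1 : 'I_n.+1, p.2) | p <- s] <= n by rewrite size_map.
exists (Bseq szt); rewrite /seq_of_boverparts /= -map_comp.
rewrite -[RHS]map_id; apply/eq_in_map=> -[x b] xs /=.
by rewrite inordK //; apply: lt_s; apply/mapP; exists (x, b).
Qed.

Lemma largestP (s : seq nat) : s != [::] ->
  largest s \in s /\ (forall x, x \in s -> x <= largest s).
Proof.
rewrite /largest => s0; split; last by move=> x xs; apply: leq_bigmax_seq.
elim: s s0 => // x [|y s] IHs _; first by rewrite big_seq1 mem_head.
rewrite big_cons; set m := \max_(_ <- y :: s) _; rewrite inE.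
by case: (leqP x m) => _; rewrite ?eqxx // [m \in _]IHs ?orbT.
Qed.

Lemma smallestP (s : seq nat) : s != [::] ->
  smallest s \in s /\ (forall x, x \in s -> smallest s <= x).
Proof.
rewrite /smallest; case: s => // a s _ /=; rewrite big_cons.
have [m_in m_le] : \big[minn/a]_(x <- s) x \in a :: s /\
    (forall x, x \in a :: s -> \big[minn/a]_(x <- s) x <= x).
  elim: s => [|y s [m_in m_le]]; first by rewrite big_nil mem_head; split=> // x; rewrite inE => /eqP->.
  rewrite big_cons; move: m_in m_le; set m := \big[_/_]_(_ <- _) _ => m_in m_le.
  split; first by case: (leqP y m) => _; move: m_in; rewrite !inE ?eqxx ?orbT // => /orP[]->; rewrite ?orbT.
  move=> x; rewrite !inE => /or3P[/eqP->|/eqP->|xs]; rewrite geq_min ?leqnn //.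
    by rewrite m_le ?mem_head ?orbT.
  by rewrite m_le ?orbT // inE xs orbT.
have /minn_idPr -> := m_le a (mem_head _ _); split=> //.
Qed.

(* Main.v *)
Require Import Defs.
From mathcomp Require Import all_boot all_order all_algebra.
From mathcomp Require Import lra.

(** Toggling the overline of the first (hence largest) part is an involution of
    the overpartitions of [n >= 1].  Each of the four statistics changes by one
    under it, so that the signs of [s] and of its image cancel, except when the
    remaining parts have no overlined part (i, ii), no non-overlined part (iii),
    or no non-overlined part smaller than the first part (iv).  The surviving
    pairs are matched with the right-hand sides: in (i)-(iii) by forgetting the
    overlines, in (iv) because the right-hand side is a sum over overpartitions
    in which exactly one member of each pair is counted. *)

Import GRing.Theory.

Local Open Scope ring_scope.

(** * Counts as integer sums over duplicate-free lists *)

Definition partitions (n : nat) : seq (seq nat) :=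
  [seq seq_of_bparts s
     | s <- enum [pred s : {bseq n of 'I_n.+1} | is_partition n (seq_of_bparts s)]].

Definition overpartitions (n : nat) : seq (seq part) :=
  [seq seq_of_boverparts s
     | s <- enum [pred s : {bseq n of 'I_n.+1 * bool}
                 | is_overpartition n (seq_of_boverparts s)]].

Lemma seq_of_bparts_inj (n : nat) : injective (@seq_of_bparts n).
Proof. by move=> s t /(inj_map val_inj)/val_inj. Qed.

Lemma seq_of_boverparts_inj (n : nat) : injective (@seq_of_boverparts n).
Proof.
by move=> s t /inj_map st; apply/val_inj/st=> -[x b] [y c] /= [/val_inj-> ->].
Qed.

Lemma partitions_uniq (n : nat) : uniq (partitions n).
Proof. by rewrite map_inj_uniq ?enum_uniq //; apply: seq_of_bparts_inj. Qed.

Lemma overpartitions_uniq (n : nat) : uniq (overpartitions n).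
Proof. by rewrite map_inj_uniq ?enum_uniq //; apply: seq_of_boverparts_inj. Qed.

Lemma mem_partitions (n : nat) (s : seq nat) :
  (s \in partitions n) = is_partition n s.
Proof.
apply/mapP/idP => [[t]|s_n]; first by rewrite mem_enum => t_n ->.
by have [t ts] := partition_bounded s_n; exists t; rewrite // mem_enum inE /= ts.
Qed.

Lemma mem_overpartitions (n : nat) (s : seq part) :
  (s \in overpartitions n) = is_overpartition n s.
Proof.
apply/mapP/idP => [[t]|s_n]; first by rewrite mem_enum => t_n ->.
by have [t ts] := overpartition_bounded s_n; exists t; rewrite // mem_enum inE /= ts.
Qed.

Lemma sum_indicator (T : Type) (r : seq T) (P : pred T) :
  (count P r)%:Z = \sum_(x <- r) (P x)%:Z.
Proof. by elim: r => [|x r IHr]; rewrite ?big_nil // big_cons /= PoszD IHr. Qed.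

Lemma num_partitionsE (n : nat) (P : pred (seq nat)) :
  (num_partitions n P)%:Z = \sum_(s <- partitions n) (P s)%:Z.
Proof.
rewrite -sum_indicator count_map -size_filter -filter_predI; congr Posz.
by rewrite /num_partitions cardE; congr size; apply: eq_filter => s; rewrite !inE andbC.
Qed.

Lemma num_overpartitionsE (n : nat) (P : pred (seq part)) :
  (num_overpartitions n P)%:Z = \sum_(s <- overpartitions n) (P s)%:Z.
Proof.
rewrite -sum_indicator count_map -size_filter -filter_predI; congr Posz.
by rewrite /num_overpartitions cardE; congr size; apply: eq_filter => s; rewrite !inE andbC.
Qed.

(** The predicate [P] is the condition shared by both counts: [1 <= SO s] in (i) and (ii), [xpredT]
    in (iii) and (iv). *)
Lemma signed_count (n : nat) (P : pred (seq part)) (l : seq part -> nat) :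
  (num_overpartitions n (fun s => P s && ~~ odd (l s)))%:Z
    - (num_overpartitions n (fun s => P s && odd (l s)))%:Z
  = \sum_(s <- overpartitions n) (P s)%:Z * (-1) ^+ l s.
Proof.
rewrite !num_overpartitionsE -sumrB; apply: eq_bigr => s _.
by rewrite -signr_odd; case: (P s); case: (odd _).
Qed.

(** * The overline condition and the toggling involution *)

Definition overlined_first (s : seq part) : bool :=
  all (fun i => (nth (0%N, false) s i).2 ==> (nth 0%N (sizes s) i \notin take i (sizes s)))
      (iota 0 (size s)).

Lemma is_overpartitionE (n : nat) (s : seq part) :
  is_overpartition n s = is_partition n (sizes s) && overlined_first s.
Proof. by []. Qed.

(** The head has an empty prefix, so its own overline is unconstrained; every later prefix gains the
    size [p.1], which no overlined part of [s] may then have. The right-hand side does not involve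
    [p.2], which is why toggling is harmless. *)
Lemma overlined_first_cons (p : part) (s : seq part) :
  overlined_first (p :: s) = (p.1 \notin overlined s) && overlined_first s.
Proof.
rewrite /overlined_first /= implybT /= -[1%N]/(1 + 0)%N iotaDl all_map.
rewrite (eq_all (a2 := predI
    (fun i => (nth (0%N, false) s i).2 ==> (nth 0%N (sizes s) i != p.1))
    (fun i => (nth (0%N, false) s i).2 ==> (nth 0%N (sizes s) i \notin take i (sizes s))))); last first.
  by move=> i; rewrite /= inE negb_or; case: (nth _ s i).2.
rewrite all_predI; congr (_ && _).
have -> : (p.1 \notin overlined s) = all (fun q : part => q.2 ==> (q.1 != p.1)) s.
  elim: s => //= -[x b] s IHs; rewrite -IHs /overlined /=.
  by case: b; rewrite //= inE negb_or eq_sym.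
(* Quantification over the parts of [s] becomes quantification over its indices. *)
rewrite -[in RHS](mkseq_nth (0%N, false) s) /mkseq all_map; apply: eq_in_all => i.
by rewrite mem_iota => /= i_s; rewrite (nth_map (0%N, false)).
Qed.

Lemma overlined_first_toggle (x : nat) (b c : bool) (t : seq part) :
  overlined_first ((x, b) :: t) = overlined_first ((x, c) :: t).
Proof. by rewrite !overlined_first_cons. Qed.

Definition toggle (s : seq part) : seq part :=
  if s is (x, b) :: t then (x, ~~ b) :: t else [::].

Lemma toggleK : involutive toggle.
Proof. by case=> [|[x b] t] //=; rewrite negbK. Qed.

Lemma is_overpartition_toggle (n : nat) (s : seq part) :
  is_overpartition n (toggle s) = is_overpartition n s.
Proof.
case: s => // -[x b] t; rewrite !is_overpartitionE.
by rewrite (overlined_first_toggle x _ b).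
Qed.

Lemma sum_overpartitions_toggle (n : nat) (f : seq part -> int) :
  \sum_(s <- overpartitions n) f (toggle s) = \sum_(s <- overpartitions n) f s.
Proof.
rewrite -(big_map toggle xpredT f); apply: perm_big; apply: uniq_perm.
- by rewrite (map_inj_uniq (inv_inj toggleK)) overpartitions_uniq.
- exact: overpartitions_uniq.
move=> s; rewrite -{1}[s]toggleK (mem_map (inv_inj toggleK)).
by rewrite !mem_overpartitions is_overpartition_toggle.
Qed.

(** * Comparison with the first part, and summation by pairs *)

Lemma head_geq (n x : nat) (t : seq part) (b : bool) :
  is_overpartition n ((x, b) :: t) -> {in sizes t, forall y, (y <= x)%N}.
Proof.
case/andP=> /and3P[/= xt_sorted _ _] _; apply/allP.
by apply: (order_path_min _ xt_sorted) => z y w /= zy /leq_trans; apply.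
Qed.

Lemma overlined_sub (s : seq part) : {subset overlined s <= sizes s}.
Proof. by move=> y /mapP[p]; rewrite mem_filter => /andP[_ ps] ->; apply: map_f. Qed.

Lemma nonoverlined_sub (s : seq part) : {subset nonoverlined s <= sizes s}.
Proof. by move=> y /mapP[p]; rewrite mem_filter => /andP[_ ps] ->; apply: map_f. Qed.

(** An overlined part of [t] is the first of its size, so it cannot share its size with the head;
    this makes the inequality strict. *)
Lemma head_gt_overlined (n x : nat) (t : seq part) (b : bool) :
  is_overpartition n ((x, b) :: t) -> {in overlined t, forall y, (y < x)%N}.
Proof.
move=> xt_n y yt; have le_yx := head_geq n x t b xt_n y (overlined_sub t y yt).
rewrite ltn_neqAle le_yx andbT; move: xt_n.
rewrite is_overpartitionE overlined_first_cons => /and3P[_ + _].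
by apply: contraNneq => <-.
Qed.

(** Adding to each sum its reindexing by [toggle] doubles it, so equality on each toggled pair
    suffices. *)
Lemma sum_overpartitions_eq (n : nat) (f g : seq part -> int) :
    (0 < n)%N ->
    (forall x t, is_overpartition n ((x, true) :: t) ->
       f ((x, true) :: t) + f ((x, false) :: t)
         = g ((x, true) :: t) + g ((x, false) :: t)) ->
  \sum_(s <- overpartitions n) f s = \sum_(s <- overpartitions n) g s.
Proof.
move=> n0 fg.
suff : \sum_(s <- overpartitions n) (f s + f (toggle s))
        = \sum_(s <- overpartitions n) (g s + g (toggle s)).
  by rewrite !big_split /= !sum_overpartitions_toggle => ?; lra.
apply: eq_big_seq => s; rewrite mem_overpartitions.
(* The empty sequence, the only fixed point of [toggle], is excluded by [0 < n]. *)
case: s => [|[x b] t xt_n]; first by move/andP=> [/and3P[_ _ /eqP/= n00]]; rewrite -n00 in n0.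
case: b xt_n => xt_n; first exact: fg.
by rewrite [LHS]addrC [RHS]addrC; apply: fg; rewrite -is_overpartition_toggle in xt_n.
Qed.

(** * Partitions as overpartitions with prescribed overlines *)

(** As a section of [sizes], [mark] identifies the partitions satisfying [P] with the overpartitions
    that equal the marking of their own sizes. *)
Lemma sum_partitions_mark (n : nat) (mark : seq nat -> seq part)
    (P : pred (seq nat)) (f : seq nat -> int) :
    cancel mark sizes ->
    {in P, forall s, is_partition n s -> is_overpartition n (mark s)} ->
  \sum_(s <- partitions n | P s) f s
  = \sum_(s <- overpartitions n | (s == mark (sizes s)) && P (sizes s)) f (sizes s).
Proof.
move=> markK mark_over.
rewrite -[LHS]big_filter -[RHS]big_filter -[RHS](big_map sizes xpredT f).
apply: perm_big; apply: uniq_perm.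
- by rewrite filter_uniq ?partitions_uniq.
- rewrite map_inj_in_uniq ?filter_uniq ?overpartitions_uniq // => s t.
  rewrite !mem_filter => /andP[/andP[/eqP s_mark _] _] /andP[/andP[/eqP t_mark _] _] st.
  by rewrite s_mark t_mark st.
move=> s; rewrite mem_filter mem_partitions; apply/andP/mapP => [[Ps s_n]|[t]].
  exists (mark s); rewrite ?markK // mem_filter mem_overpartitions markK eqxx /=.
  by rewrite Ps mark_over.
by rewrite mem_filter mem_overpartitions => /andP[/andP[_ Pt] /andP[t_n _]] ->.
Qed.

Definition mark_none (s : seq nat) : seq part := [seq (x, false) | x <- s].

Definition mark_head (s : seq nat) : seq part := toggle (mark_none s).

Definition mark_all (s : seq nat) : seq part := [seq (x, true) | x <- s].

Lemma overlined_cons (x : nat) (b : bool) (t : seq part) :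
  overlined ((x, b) :: t) = if b then x :: overlined t else overlined t.
Proof. by case: b. Qed.

Lemma nonoverlined_cons (x : nat) (b : bool) (t : seq part) :
  nonoverlined ((x, b) :: t) = if b then nonoverlined t else x :: nonoverlined t.
Proof. by case: b. Qed.

Lemma mark_noneK : cancel mark_none sizes.
Proof. by move=> s; rewrite /sizes -map_comp map_id. Qed.

Lemma mark_headK : cancel mark_head sizes.
Proof. by case=> // x s; rewrite /mark_head /= mark_noneK. Qed.

Lemma mark_allK : cancel mark_all sizes.
Proof. by move=> s; rewrite /sizes -map_comp map_id. Qed.

Lemma overlined_mark_none (s : seq nat) : overlined (mark_none s) = [::].
Proof. by elim: s. Qed.

Lemma overlined_mark_all (s : seq nat) : overlined (mark_all s) = s.
Proof. by rewrite /overlined; elim: s => //= x s ->. Qed.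

Lemma nonoverlined_mark_none (s : seq nat) : nonoverlined (mark_none s) = s.
Proof. by rewrite /nonoverlined; elim: s => //= x s ->. Qed.

Lemma nonoverlined_mark_all (s : seq nat) : nonoverlined (mark_all s) = [::].
Proof. by elim: s. Qed.

Lemma overlined_nilE (s : seq part) :
  (overlined s == [::]) = (s == mark_none (sizes s)).
Proof.
apply/eqP/eqP => [|->]; last exact: overlined_mark_none.
by elim: s => //= -[x []] // s IHs /IHs {1}->.
Qed.

Lemma nonoverlined_nilE (s : seq part) :
  (nonoverlined s == [::]) = (s == mark_all (sizes s)).
Proof.
apply/eqP/eqP => [|->]; last exact: nonoverlined_mark_all.
by elim: s => //= -[x []] // s IHs /IHs {1}->.
Qed.

Lemma overlined_first_mark_none (s : seq nat) : overlined_first (mark_none s).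
Proof. by elim: s => //= x s IHs; rewrite overlined_first_cons overlined_mark_none. Qed.

Lemma overlined_first_mark_all (s : seq nat) : overlined_first (mark_all s) = uniq s.
Proof. by elim: s => //= x s IHs; rewrite overlined_first_cons overlined_mark_all IHs. Qed.

Lemma is_overpartition_mark_head (n : nat) (s : seq nat) :
  is_partition n s -> is_overpartition n (mark_head s).
Proof.
rewrite is_overpartition_toggle is_overpartitionE mark_noneK => -> /=.
exact: overlined_first_mark_none.
Qed.

Lemma is_overpartition_mark_all (n : nat) (s : seq nat) :
  is_overpartition n (mark_all s) = is_partition n s && uniq s.
Proof.
by rewrite is_overpartitionE mark_allK overlined_first_mark_all.
Qed.

(** * Extremal sizes after adding a largest part *)

Lemma smallest1 (x : nat) : smallest [:: x] = x.
Proof. by have [] := @smallestP [:: x] isT; rewrite inE => /eqP. Qed.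

Lemma smallest_cons_geq (x : nat) (s : seq nat) :
  s != [::] -> {in s, forall y, (y <= x)%N} -> smallest (x :: s) = smallest s.
Proof.
move=> s0 le_x; have [s_in s_le] := smallestP s0.
have [xs_in xs_le] := @smallestP (x :: s) isT.
apply/eqP; rewrite eqn_leq xs_le ?inE ?s_in ?orbT //=.
move: xs_in; rewrite inE => /orP[/eqP->|/s_le //]; exact: le_x.
Qed.

Lemma largest_cons_geq (x : nat) (s : seq nat) :
  {in s, forall y, (y <= x)%N} -> largest (x :: s) = x.
Proof.
move=> le_x; have [xs_in xs_le] := @largestP (x :: s) isT.
apply/eqP; rewrite eqn_leq xs_le ?mem_head // andbT.
by move: xs_in; rewrite inE => /orP[/eqP->|/le_x].
Qed.

(** * Right-hand sides as sums over overpartitions *)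

Lemma num_p_mark (n : nat) :
  (num_p n)%:Z = \sum_(s <- overpartitions n) (s == mark_head (sizes s))%:Z.
Proof.
rewrite /num_p num_partitionsE (sum_partitions_mark _ mark_head xpredT (fun=> 1)).
- by rewrite big_mkcond; apply: eq_bigr => s _; rewrite andbT; case: eqP.
- exact: mark_headK.
- by move=> s _; apply: is_overpartition_mark_head.
Qed.

Lemma p_odd_even_mark (n : nat) :
  (p_odd n)%:Z - (p_even n)%:Z
  = \sum_(s <- overpartitions n) (s == mark_head (sizes s))%:Z
       * - (-1) ^+ count_mem (largest (sizes s)) (sizes s).
Proof.
rewrite /p_odd /p_even !num_partitionsE -sumrB.
rewrite (sum_partitions_mark _ mark_head xpredT _ mark_headK); last first.
  by move=> s _; apply: is_overpartition_mark_head.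
rewrite big_mkcond; apply: eq_bigr => s _; rewrite andbT -signr_odd.
by case: eqP => _; case: (odd _).
Qed.

(** Overlining every part is legal exactly when the parts are distinct. *)
Lemma D_even_mark (n : nat) :
  (D_even n)%:Z
  = \sum_(s <- overpartitions n) ((nonoverlined s == [::]) && ~~ odd (size s))%:Z.
Proof.
rewrite /D_even num_partitionsE.
rewrite (eq_bigr (fun s => if uniq s then (~~ odd (size s))%:Z else 0)); last first.
  by move=> s _; case: (uniq s).
rewrite -big_mkcond (sum_partitions_mark _ mark_all uniq _ mark_allK); last first.
  by move=> s s_uniq s_n; rewrite is_overpartition_mark_all s_n.
rewrite big_mkcond; apply: eq_big_seq => s; rewrite mem_overpartitions nonoverlined_nilE.
case: eqP => //= s_all; rewrite {1}s_all is_overpartition_mark_all => /andP[_ ->].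
by rewrite size_map.
Qed.

(** * Cancellation within a toggled pair *)

Lemma eq_mark_head (x : nat) (b : bool) (t : seq part) :
  ((x, b) :: t == mark_head (sizes ((x, b) :: t))) = b && (overlined t == [::]).
Proof. by rewrite /mark_head /= eqseq_cons overlined_nilE xpair_eqE eqxx; case: b. Qed.

Lemma is_overpartition_head_gt0 (n x : nat) (b : bool) (t : seq part) :
  is_overpartition n ((x, b) :: t) -> (0 < x)%N.
Proof. by case/andP=> /and3P[_ /andP[]]. Qed.

(** Common to (i) and (ii), with [c] being [<=] or [<]. If [t] has an overlined part, toggling the
    head keeps [SO] and changes the count by one, so the pair cancels. *)
Lemma signed_N_sum (n : nat) (c : nat -> pred nat) :
    (0 < n)%N -> (forall k y, (k < y)%N -> c k y) ->
  \sum_(s <- overpartitions n) (1 <= SO s)%:Z * (-1) ^+ count (c (SO s)) (nonoverlined s)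
  = \sum_(s <- overpartitions n) (s == mark_head (sizes s))%:Z
       * (-1) ^+ count (c (largest (sizes s))) (behead (sizes s)) :> int.
Proof.
move=> n0 c_gt; apply: sum_overpartitions_eq => // x t xt_n.
have x0 := is_overpartition_head_gt0 _ _ _ _ xt_n.
have le_x := head_geq _ _ _ _ xt_n.
have lt_x := head_gt_overlined _ _ _ _ xt_n.
rewrite !eq_mark_head /= mul0r addr0 largest_cons_geq //.
have [t_nil|t_o] := eqVneq (overlined t) [::].
  have -> : SO ((x, true) :: t) = x by rewrite /SO overlined_cons t_nil smallest1.
  (* By its default value, [SO] is 0 here, so this member contributes nothing. *)
  have -> : SO ((x, false) :: t) = 0%N by rewrite /SO overlined_cons t_nil /smallest big_nil.
  rewrite mul0r addr0 x0; move/eqP: t_nil; rewrite overlined_nilE => /eqP ->.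
  by rewrite nonoverlined_cons nonoverlined_mark_none mark_noneK.
have -> : SO ((x, true) :: t) = SO t.
  by apply: smallest_cons_geq => // y /overlined_sub/le_x.
have -> : SO ((x, false) :: t) = SO t by [].
have SO_lt : (SO t < x)%N by apply: lt_x; case: (smallestP t_o).
by rewrite !nonoverlined_cons /= c_gt // exprS mulN1r mulrN mul0r subrr.
Qed.

(** The non-overlined parts of [t] determine [SN] whatever the head's overline, and the head is
    counted exactly when it is overlined. *)
Lemma signed_O_cancel (x : nat) (t : seq part) (c : nat -> pred nat) :
    nonoverlined t != [::] -> {in sizes t, forall y, (y <= x)%N} -> c (SN t) x ->
  (-1) ^+ count (c (SN ((x, true) :: t))) (overlined ((x, true) :: t))
    + (-1) ^+ count (c (SN ((x, false) :: t))) (overlined ((x, false) :: t)) = 0 :> int.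
Proof.
move=> t_n le_x cx; have -> : SN ((x, true) :: t) = SN t by [].
have -> : SN ((x, false) :: t) = SN t.
  by apply: smallest_cons_geq => // y /nonoverlined_sub/le_x.
by rewrite !overlined_cons /= cx exprS mulN1r addNr.
Qed.

(** * The four identities *)

Lemma NgeO_identity (n : nat) : (0 < n)%N ->
  (A_NgeO n)%:Z - (B_NgeO n)%:Z = (p_odd n)%:Z - (p_even n)%:Z.
Proof.
move=> n0; rewrite p_odd_even_mark /A_NgeO /B_NgeO signed_count.
rewrite (signed_N_sum n leq n0 (@ltnW)).
apply: eq_big_seq => s; rewrite mem_overpartitions.
case: s => [|[x b] t] xt_n; first by case/andP: xt_n n0 => /and3P[_ _ /eqP <-].
have le_x := head_geq _ _ _ _ xt_n.
(* The first part is itself an occurrence of the largest size, which absorbs the minus sign; later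
   parts of size at least [x] have size exactly [x]. *)
rewrite /= largest_cons_geq // eqxx exprS mulN1r opprK; congr (_ * (-1) ^+ _).
by apply: eq_in_count => y /le_x le_yx /=; rewrite eqn_leq le_yx.
Qed.

Lemma NgtO_identity (n : nat) : (0 < n)%N ->
  (A_NgtO n)%:Z - (B_NgtO n)%:Z = (num_p n)%:Z.
Proof.
move=> n0; rewrite num_p_mark /A_NgtO /B_NgtO signed_count.
rewrite (signed_N_sum n (fun k y => k < y)%N n0) //.
apply: eq_big_seq => s; rewrite mem_overpartitions.
case: s => [|[x b] t] xt_n; first by case/andP: xt_n n0 => /and3P[_ _ /eqP <-].
have le_x := head_geq _ _ _ _ xt_n.
(* No later part exceeds the first, so every surviving sign is 1. *)
rewrite /= largest_cons_geq // (eq_in_count (a2 := pred0)) ?count_pred0 ?mulr1 //.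
by move=> y /le_x le_yx /=; rewrite ltnNge le_yx.
Qed.

Lemma OgeN_identity (n : nat) : (0 < n)%N ->
  (A_OgeN n)%:Z - (B_OgeN n)%:Z = 2 * (D_even n)%:Z.
Proof.
move=> n0; rewrite D_even_mark (signed_count n xpredT) mulr_sumr.
apply: sum_overpartitions_eq => // x t xt_n; rewrite !mul1r.
have le_x := head_geq _ _ _ _ xt_n.
have lt_x := head_gt_overlined _ _ _ _ xt_n.
have [t_nil|t_n] := eqVneq (nonoverlined t) [::]; last first.
  rewrite /ell_OgeN (signed_O_cancel x t leq) //.
  by apply/le_x/nonoverlined_sub; case: (smallestP t_n).
have ell_f : ell_OgeN ((x, false) :: t) = 0%N.
  rewrite /ell_OgeN /SN nonoverlined_cons t_nil smallest1.
  rewrite (eq_in_count (a2 := pred0)) ?count_pred0 // => y /lt_x.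
  by rewrite ltnNge => /negPf.
(* Here [SN] takes its default value 0, so all parts are counted, the head included. *)
have ell_t : ell_OgeN ((x, true) :: t) = (size t).+1.
  rewrite /ell_OgeN /SN nonoverlined_cons t_nil /smallest big_nil overlined_cons /=.
  move/eqP: t_nil; rewrite nonoverlined_nilE => /eqP ->.
  by rewrite overlined_mark_all count_predT !size_map.
(* The signs add up to 2 or 0 according to the parity of [(size t).+1], the length of the only fully
   overlined member. *)
rewrite ell_f ell_t -signr_odd !nonoverlined_cons t_nil /=.
by case: (odd _).
Qed.

Lemma OgtN_identity (n : nat) : (0 < n)%N ->
  (A_OgtN n)%:Z - (B_OgtN n)%:Z = 2 * (H_ON_odd n)%:Z.
Proof.
move=> n0; rewrite (signed_count n xpredT) /H_ON_odd num_overpartitionsE mulr_sumr.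
apply: sum_overpartitions_eq => // x t xt_n; rewrite !mul1r.
have x0 := is_overpartition_head_gt0 _ _ _ _ xt_n.
have le_x := head_geq _ _ _ _ xt_n.
have lt_x := head_gt_overlined _ _ _ _ xt_n.
have le_x_o : {in overlined t, forall y, (y <= x)%N} by move=> y /lt_x/ltnW.
have le_x_n : {in nonoverlined t, forall y, (y <= x)%N} by move=> y /nonoverlined_sub/le_x.
have LN_f : LN ((x, false) :: t) = x by apply: largest_cons_geq.
have LO_t : LO ((x, true) :: t) = x by apply: largest_cons_geq.
have LO_f : (LO ((x, false) :: t) <= x)%N.
  by rewrite /LO overlined_cons /largest; apply/bigmax_leqP_seq => y /le_x_o.
have no_gt_x : count (ltn x) (overlined t) = 0%N.
  rewrite (eq_in_count (a2 := pred0)) ?count_pred0 // => y /le_x_o.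
  by rewrite leqNgt => /negPf.
have [t_nil|t_n] := eqVneq (nonoverlined t) [::].
  have SN_f : SN ((x, false) :: t) = x by rewrite /SN nonoverlined_cons t_nil smallest1.
  (* By this default value the member is not counted by [H_ON_odd], while all its overlined parts
     exceed [SN]. *)
  have SN_t : SN ((x, true) :: t) = 0%N.
    by rewrite /SN nonoverlined_cons t_nil /smallest big_nil.
  have o_gt0 : count (ltn 0) (overlined t) = size (overlined t).
    case/andP: xt_n => /and3P[_ /andP[_ /allP t_gt0] _] _.
    apply/eqP; rewrite -all_count; apply/allP => y /overlined_sub; exact: t_gt0.
  rewrite LN_f SN_f SN_t LO_f eqxx x0 andbF /ell_OgtN SN_f SN_t !overlined_cons /= no_gt_x.
  (* With [k] overlined parts in [t], the signs add up to [1 + (-1) ^+ k.+1], which is 2 exactly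
     when [k] is odd. *)
  by rewrite x0 o_gt0 exprS -signr_odd; case: (odd _).
have SN_t : SN ((x, true) :: t) = SN t by [].
have SN_f : SN ((x, false) :: t) = SN t by apply: smallest_cons_geq.
have [SN_in SN_le] := smallestP t_n.
(* If [SN t < x], the signs cancel and [H_ON_odd] counts neither member: [LO] exceeds [SN] when the
   head is overlined, [LN] does otherwise. *)
have := le_x_n _ SN_in; rewrite -/(SN t) leq_eqVlt => /orP[/eqP SN_x|SN_lt]; last first.
  rewrite /ell_OgtN (signed_O_cancel x t (fun k y => k < y)%N) //.
  by rewrite LN_f SN_f SN_t LO_t (gtn_eqF SN_lt) (leqNgt x) SN_lt !andbF.
have LN_t : LN ((x, true) :: t) = x.
  have [LN_in LN_ge] := largestP t_n.
  by apply/eqP; rewrite eqn_leq le_x_n //= -{1}SN_x LN_ge.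
(* No overlined part exceeds [SN], so both signs are 1; the numbers of overlined parts differ by
   one, so exactly one member is counted on the right. *)
rewrite LN_f LN_t SN_f SN_t LO_t SN_x LO_f eqxx x0 leqnn.
rewrite /ell_OgtN SN_f SN_t SN_x !overlined_cons /=.
by rewrite ltnn no_gt_x; case: (odd _).
Qed.

Theorem theorem1p2 (n : nat) (hn : (1 <= n)%N) :
  [/\ (A_NgeO n)%:Z - (B_NgeO n)%:Z = (p_odd n)%:Z - (p_even n)%:Z,
      (A_NgtO n)%:Z - (B_NgtO n)%:Z = (num_p n)%:Z,
      (A_OgeN n)%:Z - (B_OgeN n)%:Z = 2 * (D_even n)%:Z
    & (A_OgtN n)%:Z - (B_OgtN n)%:Z = 2 * (H_ON_odd n)%:Z].
Proof.
split; first exact: NgeO_identity.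
- exact: NgtO_identity.
- exact: OgeN_identity.
- exact: OgtN_identity.
Qed.
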